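(* Let $H$ be a weighted hypergraph (every vertex in some hyperedge, every hyperedge with non-empty support) whose spectral decomposition is $\{(V_1,E_1),\dots,(V_k,E_k)\}$ with densities $\alpha_1>\dots>\alpha_k>0$. Then $\{(E_k,V_k),\dots,(E_1,V_1)\}$ is the spectral decomposition of the dual weighted hypergraph $H^*$, with densities $\alpha_k^{-1}>\dots>\alpha_1^{-1}>0$.
   Context: A weighted hypergraph $H=(V,E,\mathrm{supp})$ has finite vertex set $V$, finite hyperedge set $E$, support map $\mathrm{supp}:E\to\mathcal P(V)$ and positive weights on vertices and hyperedges; $\mathrm{wt}$ of a set is the sum of weights. A subgraph is a pair $(V',E')$, $V'\subset V$, $E'\subset E$, with $\mathrm{supp}(e)\subset V'$ for all $e\in E'$; its density is $\mathrm{wt}(E')/\mathrm{wt}(V')$. A quotient hypergraph is a pair $(V'',E'')$ such that every hyperedge of $H$ whose support meets $V''$ lies in $E''$, with support $\mathrm{supp}(e)\cap V''$; for a subgraph $(V',E')$, the pair $(V\setminus V',E\setminus E')$ is a quotient hypergraph. In any weighted hypergraph there is a unique subgraph of maximum density that is maximal under componentwise inclusion. The spectral decomposition of $H$ is the partition $V=V_{1}\sqcup\dots\sqcup V_{k}$, $E=E_{1}\sqcup\dots\sqcup E_{k}$ defined inductively: $(V_t,E_t)$ is the maximal subgraph of maximum density $\alpha_t$ in the quotient hypergraph $(V\setminus\bigcup_{r<t}V_r,\,E\setminus\bigcup_{r<t}E_r)$, $t=1,\dots,k$. The dual hypergraph $H^*$ has vertex set $E$ and hyperedge set $V$, with $e\in\mathrm{supp}^*(v)$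 iff $v\in\mathrm{supp}(e)$; the weight of each element is the same as in $H$ (vertex weights of $H$ become hyperedge weights of $H^*$ and vice versa). *)

(* Defs.v *)
From HB Require Import structures.
From mathcomp Require Import all_boot all_order all_algebra.

Set Implicit Arguments.
Unset Strict Implicit.
Unset Printing Implicit Defensive.

Import Order.TTheory GRing.Theory Num.Theory.
Local Open Scope ring_scope.

(* The vertex set and the hyperedge set are finite subsets of ambient finite
   types, so that a quotient is again a hypergraph over the same types.  The
   values of supp, vwt and ewt outside these subsets are irrelevant. *)
Record whypergraph (R : realFieldType) (VT ET : finType) := WHypergraph {
  vertices : {set VT};
  hyperedges : {set ET};
  supp : ET -> {set VT};
  vwt : VT -> R;
  ewt : ET -> R;
  supp_sub : forall e, e \in hyperedges -> supp e \subset vertices;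
  vwt_gt0 : forall v, v \in vertices -> 0 < vwt v;
  ewt_gt0 : forall e, e \in hyperedges -> 0 < ewt e
}.

Section Hypergraph.
Variables (R : realFieldType) (VT ET : finType).
Implicit Type H : whypergraph R VT ET.

Definition no_isolated H : Prop :=
  (forall v, v \in vertices H ->
     exists2 e, e \in hyperedges H & v \in supp H e) /\
  (forall e, e \in hyperedges H -> supp H e != set0).

Definition subgraph H (V' : {set VT}) (E' : {set ET}) : Prop :=
  [/\ V' \subset vertices H, E' \subset hyperedges H
    & forall e, e \in E' -> supp H e \subset V'].

Definition density H (V' : {set VT}) (E' : {set ET}) : R :=
  (\sum_(e in E') ewt H e) / (\sum_(v in V') vwt H v).

(* Densities are only compared between subgraphs having at least one vertex:
   otherwise the denominator vanishes. *)
Definition densest H (V' : {set VT}) (E' : {set ET}) : Prop :=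
  [/\ subgraph H V' E', V' != set0
    & forall V2 E2, subgraph H V2 E2 -> V2 != set0 ->
        density H V2 E2 <= density H V' E'].

Definition maximal_densest H (V' : {set VT}) (E' : {set ET}) : Prop :=
  densest H V' E' /\
  forall V2 E2, densest H V2 E2 -> V' \subset V2 -> E' \subset E2 ->
    V2 = V' /\ E2 = E'.

Definition quotient_pair H (V2 : {set VT}) (E2 : {set ET}) : Prop :=
  [/\ V2 \subset vertices H, E2 \subset hyperedges H
    & forall e, e \in hyperedges H -> supp H e :&: V2 != set0 -> e \in E2].

Section Quotient.
Variables (H : whypergraph R VT ET) (V2 : {set VT}) (E2 : {set ET}).

Fact quotient_supp_sub e : e \in hyperedges H :&: E2 ->
  supp H e :&: V2 \subset vertices H :&: V2.
Proof. by case/setIP=> /supp_sub eH _; apply: setSI. Qed.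

Fact quotient_vwt_gt0 v : v \in vertices H :&: V2 -> 0 < vwt H v.
Proof. by case/setIP=> /vwt_gt0. Qed.

Fact quotient_ewt_gt0 e : e \in hyperedges H :&: E2 -> 0 < ewt H e.
Proof. by case/setIP=> /ewt_gt0. Qed.

(* When quotient_pair H V2 E2 holds, the vertex set is V2 and the hyperedge set
   is E2; the intersections only make the construction total. *)
Definition quotient_hypergraph : whypergraph R VT ET :=
  WHypergraph quotient_supp_sub quotient_vwt_gt0 quotient_ewt_gt0.

End Quotient.

Lemma subgraph_quotient_pair H V' E' : subgraph H V' E' ->
  quotient_pair H (vertices H :\: V') (hyperedges H :\: E').
Proof.
case=> _ _ sE; split; rewrite ?subsetDl // => e eH /set0Pn[v].
rewrite !inE eH andbT => /and3P[ve vV' _].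
by apply: contra vV' => /sE/subsetP; apply.
Qed.

Section Spectral.
Variables (H : whypergraph R VT ET) (k : nat).
Variables (Vs : 'I_k -> {set VT}) (Es : 'I_k -> {set ET}) (alpha : 'I_k -> R).

Definition remaining_vertices (t : 'I_k) : {set VT} :=
  vertices H :\: \bigcup_(r < k | (r < t)%N) Vs r.

Definition remaining_hyperedges (t : 'I_k) : {set ET} :=
  hyperedges H :\: \bigcup_(r < k | (r < t)%N) Es r.

Definition spectral_partition : Prop :=
  [/\ \bigcup_(t < k) Vs t = vertices H,
      \bigcup_(t < k) Es t = hyperedges H,
      forall r t : 'I_k, r != t -> [disjoint Vs r & Vs t]
    & forall r t : 'I_k, r != t -> [disjoint Es r & Es t]].

Definition spectral_step (t : 'I_k) : Prop :=
  let Ht :=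
    quotient_hypergraph H (remaining_vertices t) (remaining_hyperedges t) in
  [/\ quotient_pair H (remaining_vertices t) (remaining_hyperedges t),
      maximal_densest Ht (Vs t) (Es t)
    & alpha t = density Ht (Vs t) (Es t)].

(* The index t : 'I_k is 0-based. *)
Definition spectral_decomposition : Prop :=
  spectral_partition /\ forall t : 'I_k, spectral_step t.

End Spectral.

Section Dual.
Variable H : whypergraph R VT ET.

Definition dual_supp (v : VT) : {set ET} :=
  [set e in hyperedges H | v \in supp H e].

Fact dual_supp_sub v : v \in vertices H -> dual_supp v \subset hyperedges H.
Proof. by move=> _; apply/subsetP => e; rewrite inE => /andP[]. Qed.

Definition dual_hypergraph : whypergraph R ET VT :=
  WHypergraph dual_supp_sub (@ewt_gt0 _ _ _ H) (@vwt_gt0 _ _ _ H).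

End Dual.

End Hypergraph.

Definition decreasing_positive (R : realFieldType) (k : nat)
    (alpha : 'I_k -> R) : Prop :=
  (forall i j : 'I_k, (i < j)%N -> alpha j < alpha i) /\
  (forall i : 'I_k, 0 < alpha i).

(* Main.v *)
Require Import Defs.
From HB Require Import structures.
From mathcomp Require Import all_boot all_order all_algebra.

Set Implicit Arguments.
Unset Strict Implicit.
Unset Printing Implicit Defensive.

Import Order.TTheory GRing.Theory Num.Theory.
Local Open Scope ring_scope.

(** If (V', E') is a subgraph of the dual quotient in which only the blocks
    j <= s remain, then (V_j \ V', E_j \ E') is a subgraph of the j-th quotient
    of H, so the maximality of alpha_j, subtracted from
    wt(E_j) = alpha_j wt(V_j), gives
    alpha_j wt(V_j :&: V') <= wt(E_j :&: E').  As alpha_s <= alpha_j, summing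
    over j <= s bounds the dual density wt(V') / wt(E') by alpha_s^-1; equality
    forces V' and E' to miss every block j < s, where alpha_s < alpha_j. *)

(** * Weights of finite sets *)

Section Weight.
Variables (R : realFieldType) (T : finType).
Implicit Types (f : T -> R) (A B : {set T}).

Definition wt f A : R := \sum_(x in A) f x.

Lemma wt_split f A B : wt f A = wt f (A :&: B) + wt f (A :\: B).
Proof. by rewrite /wt (big_setID B). Qed.

Lemma wtU f A B : [disjoint A & B] -> wt f (A :|: B) = wt f A + wt f B.
Proof.
rewrite disjoint_sym => /setDidPl dAB.
by rewrite (wt_split f (A :|: B) A) setUK setDUl setDv set0U dAB.
Qed.

Lemma wt_ge0 f A : (forall x, x \in A -> 0 < f x) -> 0 <= wt f A.
Proof. by move=> f0; apply: sumr_ge0 => x /f0/ltW. Qed.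

Lemma wt_gt0 f A : (forall x, x \in A -> 0 < f x) -> A != set0 -> 0 < wt f A.
Proof.
move=> f0 /set0Pn[x xA]; rewrite /wt (bigD1 x) //= ltr_wpDr ?f0 //.
by apply: sumr_ge0 => y /andP[yA _]; apply/ltW/f0.
Qed.

Lemma wt_le f A B : (forall x, x \in B -> 0 < f x) -> A \subset B ->
  wt f A <= wt f B.
Proof.
move=> f0 /setIidPr sAB; rewrite (wt_split f B A) sAB lerDl wt_ge0 //.
by move=> x /setDP[/f0].
Qed.

Lemma wt_eq0 f A : (forall x, x \in A -> 0 < f x) -> wt f A = 0 -> A = set0.
Proof.
by move=> f0 wA; apply/eqP; apply: contraT => /(wt_gt0 f0); rewrite wA ltxx.
Qed.

(** * Partitions of a set into blocks indexed by an ordinal *)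

Section Partition.
Variables (k : nat) (P : 'I_k -> {set T}) (D : {set T}).
Hypothesis covP : \bigcup_(t < k) P t = D.
Hypothesis disjP : forall r t : 'I_k, r != t -> [disjoint P r & P t].

Lemma block_inj x r t : x \in P r -> x \in P t -> r = t.
Proof.
move=> xr xt; apply/eqP; apply: contraT => /disjP/disjointFr/(_ xr).
by rewrite xt.
Qed.

Lemma block_sub t : P t \subset D.
Proof. by rewrite -covP bigcup_sup. Qed.

Lemma mem_blockE x : x \in D -> exists t, x \in P t.
Proof. by rewrite -covP => /bigcupP[t _ xt]; exists t. Qed.

Lemma mem_tail (t j : 'I_k) x : x \in P j ->
  (x \in D :\: \bigcup_(r < k | (r < t)%N) P r) = (t <= j)%N.
Proof.
move=> xj; have xD := subsetP (block_sub j) x xj.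
rewrite inE xD andbT leqNgt; congr (~~ _); apply/bigcupP/idP.
  by case=> r rt xr; rewrite (block_inj xj xr).
by exists j.
Qed.

Lemma wt_blocks f A : A \subset D -> wt f A = \sum_(j < k) wt f (P j :&: A).
Proof.
move=> sAD; rewrite -(partition_disjoint_bigcup _ f) => [|i j /disjP dij].
  by rewrite -big_distrl /= covP (setIidPr sAD).
by apply: disjointWl (subsetIl _ _) (disjointWr (subsetIl _ _) dij).
Qed.

End Partition.
End Weight.

(** Clearing denominators makes the density conditions linear in the weights, so that they can be
    subtracted and summed over blocks. Maximality under inclusion becomes the equality case of the
    linear bound. *)
Lemma maximal_densestP (R : realFieldType) (VT ET : finType)
    (G : whypergraph R VT ET) (A : {set VT}) (B : {set ET}) (a : R) :
  (maximal_densest G A B /\ a = density G A B) <->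
  [/\ subgraph G A B, A != set0, wt (ewt G) B = a * wt (vwt G) A
    & forall V2 E2, subgraph G V2 E2 -> V2 != set0 ->
        wt (ewt G) E2 <= a * wt (vwt G) V2 /\
        (A \subset V2 -> B \subset E2 ->
         wt (ewt G) E2 = a * wt (vwt G) V2 -> V2 = A /\ E2 = B)].
Proof.
have pos V2 E2 : subgraph G V2 E2 -> V2 != set0 -> 0 < wt (vwt G) V2.
  by case=> /subsetP sV _ _; apply: wt_gt0 => v /sV/vwt_gt0.
rewrite /density -/(wt _ A) -/(wt _ B); split=> [[[[sAB A0 dns] mx] ->]|].
  have wA := pos _ _ sAB A0; split=> // [|V2 E2 s2 V20].
    by rewrite mulfVK ?gt_eqF.
  have wV := pos _ _ s2 V20; split=> [|sA sB eq].
    by rewrite -ler_pdivrMr //; apply: dns.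
  apply: mx => //; split=> // V3 E3 s3 V30.
  have -> : density G V2 E2 = density G A B.
    by rewrite /density -/(wt _ V2) -/(wt _ E2) eq mulfK ?gt_eqF.
  exact: dns.
case=> sAB A0 eqa bnd; have wA := pos _ _ sAB A0.
have aE : a = density G A B by rewrite /density -/(wt _ B) eqa mulfK ?gt_eqF.
split=> //; split.
  split=> // V2 E2 s2 V20; rewrite -aE ler_pdivrMr ?(pos _ _ s2) //.
  by case: (bnd _ _ s2 V20).
move=> V2 E2 [s2 V20 d2] sA sB; have [le2 eq2] := bnd _ _ s2 V20.
apply: eq2 => //; apply/eqP; rewrite eq_le le2 /=.
by rewrite -ler_pdivlMr ?(pos _ _ s2) // aE; apply: d2.
Qed.

(** * Structure of a spectral decomposition *)

Section SpectralFacts.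
Variables (R : realFieldType) (VT ET : finType) (H : whypergraph R VT ET).
Variables (k : nat) (Vs : 'I_k -> {set VT}) (Es : 'I_k -> {set ET}).
Variable alpha : 'I_k -> R.
Hypothesis H_noniso : no_isolated H.
Hypothesis H_spec : spectral_decomposition H Vs Es alpha.

Let covV : \bigcup_(t < k) Vs t = vertices H.
Proof. by case: H_spec => -[]. Qed.
Let covE : \bigcup_(t < k) Es t = hyperedges H.
Proof. by case: H_spec => -[]. Qed.
Let disV r t : r != t -> [disjoint Vs r & Vs t].
Proof. by case: H_spec => -[_ _ + _] _; apply. Qed.
Let disE r t : r != t -> [disjoint Es r & Es t].
Proof. by case: H_spec => -[_ _ _ +] _; apply. Qed.

Let quot t := quotient_hypergraph H
  (remaining_vertices H Vs t) (remaining_hyperedges H Es t).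

Lemma vertices_quot t : vertices (quot t) = remaining_vertices H Vs t.
Proof. exact/setIidPr/subsetDl. Qed.

Lemma hyperedges_quot t : hyperedges (quot t) = remaining_hyperedges H Es t.
Proof. exact/setIidPr/subsetDl. Qed.

Lemma spectral_bound t :
  [/\ subgraph (quot t) (Vs t) (Es t), Vs t != set0,
      wt (ewt H) (Es t) = alpha t * wt (vwt H) (Vs t)
    & forall V2 E2, subgraph (quot t) V2 E2 -> V2 != set0 ->
        wt (ewt H) E2 <= alpha t * wt (vwt H) V2 /\
        (Vs t \subset V2 -> Es t \subset E2 ->
         wt (ewt H) E2 = alpha t * wt (vwt H) V2 -> V2 = Vs t /\ E2 = Es t)].
Proof.
case: H_spec => _ /(_ t)[_ m1 m2].
by have /maximal_densestP := conj m1 m2.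
Qed.

Lemma Vs_gt0 t v : v \in Vs t -> 0 < vwt H v.
Proof. by move=> vt; apply/vwt_gt0/(subsetP (block_sub covV t)). Qed.

Lemma Es_gt0 t e : e \in Es t -> 0 < ewt H e.
Proof. by move=> et; apply/ewt_gt0/(subsetP (block_sub covE t)). Qed.

Lemma Vs_wt_gt0 t : 0 < wt (vwt H) (Vs t).
Proof. by case: (spectral_bound t) => _ V0 _ _; apply: wt_gt0 (@Vs_gt0 t) V0. Qed.

(** A vertex of a block after [s] is still present in the quotient at [s], where the subgraph
    condition on [e] would force it into [Vs s]. *)
Lemma supp_in_block e s v : e \in Es s -> v \in supp H e ->
  exists2 j : 'I_k, v \in Vs j & (j <= s)%N.
Proof.
move=> es ve.
have eH := subsetP (block_sub covE s) e es.
have /(mem_blockE covV)[j vj] := subsetP (supp_sub eH) v ve.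
exists j => //; rewrite leqNgt; apply/negP => sj.
have [[_ _ /(_ e es)/subsetP/(_ v)]] := spectral_bound s.
rewrite inE ve (mem_tail covV disV s vj) ltnW // => /(_ isT) vs _ _ _.
by move: sj; rewrite (block_inj disV vs vj) ltnn.
Qed.

Lemma supp_block_le e s v j : e \in Es s -> v \in supp H e -> v \in Vs j ->
  (j <= s)%N.
Proof.
by move=> es /(supp_in_block es)[i vi js] vj; rewrite (block_inj disV vj vi).
Qed.

(* If [r] is the last block met by [supp e], then [e] can be added to [Es r]
   without lowering the density, hence it already belongs to [Es r]. *)
Lemma supp_meets_block e s : e \in Es s ->
  exists2 v, v \in supp H e & v \in Vs s.
Proof.
move=> es; have eH := subsetP (block_sub covE s) e es.
have [v0 v0e] : exists v, v \in supp H e by apply/set0Pn; case: H_noniso => _; apply.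
have [j0 v0j _] := supp_in_block es v0e.
have p0 : supp H e :&: Vs j0 != set0 by apply/set0Pn; exists v0; rewrite inE v0e.
case: (@arg_maxnP _ j0 [pred r | supp H e :&: Vs r != set0] (@nat_of_ord k) p0).
move=> r /= /set0Pn[v /setIP[ve vr]] rmax.
have [sub Vr0 eqr bnd] := spectral_bound r; case: (sub) => sV sE sS.
have rs := supp_block_le es ve vr.
suff er : e \in Es r by exists v; rewrite // (block_inj disE es er).
have s2 : subgraph (quot r) (Vs r) (e |: Es r).
  split=> //.
    by rewrite subUset sE sub1set hyperedges_quot (mem_tail covE disE r es) rs.
  (* The quotient at [r] keeps only blocks from [r] on, and [supp H e] meets none after [r], so what
     remains of it lies in [Vs r]. *)
  move=> e' /setU1P[->|/sS //]; apply/subsetP => w /setIP[we wr].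
  have [j wj _] := supp_in_block es we.
  have jr : (j <= r)%N by apply: rmax; apply/set0Pn; exists w; rewrite inE we.
  have rj : (r <= j)%N by rewrite -(mem_tail covV disV r wj).
  by have -> : r = j by apply/val_inj/anti_leq; rewrite rj.
have [le2 eq2] := bnd _ _ s2 Vr0.
have le3 : wt (ewt H) (Es r) <= wt (ewt H) (e |: Es r).
  by apply: wt_le (subsetUr _ _) => e' /setU1P[->|/Es_gt0//]; apply: ewt_gt0.
have [] := eq2 (subxx _) (subsetUr _ _).
  by apply/eqP; rewrite eq_le le2 -eqr.
by move=> _ <-; rewrite setU11.
Qed.

(** A hyperedge through a vertex of [Vs t] survives in the quotient at [t], so the whole quotient,
    taken as a subgraph of itself, has positive density, and [alpha t] is at least that. *)
Lemma alpha_gt0 t : 0 < alpha t.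
Proof.
have [[sV _ _] /set0Pn[v vt] _ bnd] := spectral_bound t.
have vH := subsetP (block_sub covV t) v vt.
have [e eH ve] := (H_noniso.1 v vH).
have eR : e \in remaining_hyperedges H Es t.
  have [qp _ _] := H_spec.2 t; case: qp => _ _; apply=> //.
  by apply/set0Pn; exists v; rewrite inE ve (mem_tail covV disV t vt) /=.
have s2 : subgraph (quot t) (vertices (quot t)) (hyperedges (quot t)).
  by split=> // e' /supp_sub.
have V20 : vertices (quot t) != set0.
  by apply/set0Pn; exists v; apply: (subsetP sV).
have [le2 _] := bnd _ _ s2 V20.
have wE : 0 < wt (ewt H) (hyperedges (quot t)).
  apply: wt_gt0 => [e' /setIP[/ewt_gt0 //]|].
  by apply/set0Pn; exists e; rewrite hyperedges_quot.
have wV : 0 < wt (vwt H) (vertices (quot t)).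
  by apply: wt_gt0 V20 => v' /setIP[/vwt_gt0].
by rewrite -(pmulr_lgt0 _ wV); apply: lt_le_trans le2.
Qed.

Lemma Es_neq0 t : Es t != set0.
Proof.
have [_ _ eqt _] := spectral_bound t.
apply: contra_eq_neq eqt => ->; rewrite /wt big_set0 lt_eqF //.
by rewrite mulr_gt0 ?alpha_gt0 ?Vs_wt_gt0.
Qed.

(** Otherwise the union of the two blocks would be a subgraph of the quotient at [s] with density at
    least [alpha s], against the maximality of block [s]. *)
Lemma alpha_succ (s t : 'I_k) : t = s.+1 :> nat -> alpha t < alpha s.
Proof.
move=> ts; rewrite ltNge; apply/negP => ast.
have st : (s < t)%N by rewrite ts.
have nst : s != t by rewrite -val_eqE /= ltn_eqF.
have [[sV sE sS] Vs0 eqs bnd] := spectral_bound s.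
have [[tV tE tS] Vt0 eqt _] := spectral_bound t.
have s2 : subgraph (quot s) (Vs s :|: Vs t) (Es s :|: Es t).
  split.
  - rewrite subUset sV; apply/subsetP => v vt.
    by rewrite vertices_quot (mem_tail covV disV s vt) ltnW.
  - rewrite subUset sE; apply/subsetP => e et.
    by rewrite hyperedges_quot (mem_tail covE disE s et) ltnW.
  move=> e /setUP[/sS/subset_trans -> //|et]; first exact: subsetUl.
  (* Here the blocks must be consecutive: in the quotient at [s], the support of a hyperedge of
     [Es t] meets only blocks from [s] to [t]. *)
  apply/subsetP => v /setIP[ve vs].
  have [j vj jt] := supp_in_block et ve.
  have sj : (s <= j)%N by rewrite -(mem_tail covV disV s vj).
  rewrite inE; move: sj; rewrite leq_eqVlt -ts => /orP[/eqP|] sj.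
    by rewrite (val_inj sj : s = j) vj.
  have -> : t = j by apply/val_inj/anti_leq; rewrite jt sj.
  by rewrite vj orbT.
have V20 : Vs s :|: Vs t != set0.
  by apply: contraNneq Vs0 => /eqP; rewrite setU_eq0 => /andP[].
have [le2 eq2] := bnd _ _ s2 V20.
have [] := eq2 (subsetUl _ _) (subsetUl _ _).
  apply/eqP; rewrite eq_le le2 (wtU _ (disV nst)) (wtU _ (disE nst)) eqs eqt.
  by rewrite mulrDr lerD2l ler_pM2r ?Vs_wt_gt0.
move/setUidPl => sts _; case/set0Pn: Vt0 => v vt.
by have := block_inj disV vt (subsetP sts v vt) => /eqP; rewrite eq_sym (negPf nst).
Qed.

Lemma alpha_decreasing (s t : 'I_k) : (s < t)%N -> alpha t < alpha s.
Proof.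
case: t => m; elim: m => // m IHm mk /=; rewrite ltnS leq_eqVlt.
case/orP => [/eqP sm|sm]; first by apply: alpha_succ; rewrite /= sm.
have mk' := ltnW mk; apply: lt_trans (IHm mk' sm).
exact: alpha_succ.
Qed.

(* Removing a subgraph of the dual leaves a subgraph of each quotient, so that
   the density bound there turns into the reverse bound on what was removed. *)
Lemma removal_bound (s j : 'I_k) (V' : {set VT}) (E' : {set ET}) :
    (j <= s)%N ->
    (forall v e (i : 'I_k), v \in V' -> (i <= s)%N -> e \in Es i -> v \in supp H e ->
       e \in E') ->
  alpha j * wt (vwt H) (Vs j :&: V') <= wt (ewt H) (Es j :&: E').
Proof.
move=> js clos; have [[sV sE sS] _ eqj bnd] := spectral_bound j.
have sub : subgraph (quot j) (Vs j :\: V') (Es j :\: E').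
  split; rewrite ?(subset_trans (subsetDl _ _)) // => e /setDP[ej eE].
  rewrite subsetD sS //=; apply/pred0P => v /=; apply/negP.
  case/andP => /setIP[ve _] vV'; case/negP: eE; exact: clos vV' js ej ve.
have le : wt (ewt H) (Es j :\: E') <= alpha j * wt (vwt H) (Vs j :\: V').
  (* The density bound covers only nonempty vertex sets. If [Vs j :\: V'] is empty, so is
     [Es j :\: E'], since each hyperedge of [Es j] has a vertex in [Vs j]. *)
  have [V0|] := boolP (Vs j :\: V' == set0); last by case/(bnd _ _ sub).
  suff -> : Es j :\: E' = set0.
    by rewrite (eqP V0) /wt !big_set0 mulr0.
  apply/eqP; apply: contraLR V0 => /set0Pn[e /setDP[ej eE]].
  have [v ve vj] := supp_meets_block ej.
  apply/set0Pn; exists v; rewrite inE vj andbT.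
  by apply: contra eE => vV'; apply: clos vV' js ej ve.
move: eqj; rewrite (wt_split _ _ E') (wt_split _ (Vs j) V') mulrDr => eqj.
by rewrite -(lerD2r (wt (ewt H) (Es j :\: E'))) eqj lerD2l.
Qed.

(** * The dual hypergraph, with the blocks in reverse order *)

Let dual := dual_hypergraph H.
Let Vd t := Es (rev_ord t).
Let Ed t := Vs (rev_ord t).

Lemma dual_partition : spectral_partition dual Vd Ed.
Proof.
split.
- by rewrite [RHS]/= -covE [RHS](reindex_inj rev_ord_inj).
- by rewrite [RHS]/= -covV [RHS](reindex_inj rev_ord_inj).
- by move=> r t rt; apply: disE; rewrite (inj_eq rev_ord_inj).
- by move=> r t rt; apply: disV; rewrite (inj_eq rev_ord_inj).
Qed.

(** Turns the final segment of reversed indices given by [mem_tail] into the initial segment of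
    original blocks up to [rev_ord t]. *)
Lemma rev_ord_le (t j : 'I_k) : (t <= rev_ord j)%N = (j <= rev_ord t)%N.
Proof. by rewrite /= !leq_subRL // !addSn addnC. Qed.

Lemma mem_dual_vertices t j e : e \in Es j ->
  (e \in remaining_vertices dual Vd t) = (j <= rev_ord t)%N.
Proof.
case: dual_partition => cov _ dis _ ej; rewrite -rev_ord_le.
by apply: mem_tail cov dis _ _ _ _; rewrite /Vd rev_ordK.
Qed.

Lemma mem_dual_hyperedges t j v : v \in Vs j ->
  (v \in remaining_hyperedges dual Ed t) = (j <= rev_ord t)%N.
Proof.
case: dual_partition => _ cov _ dis vj; rewrite -rev_ord_le.
by apply: mem_tail cov dis _ _ _ _; rewrite /Ed rev_ordK.
Qed.

Lemma dual_step t :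
  spectral_step dual Vd Ed (fun t => (alpha (rev_ord t))^-1) t.
Proof.
set s := rev_ord t.
pose qd := quotient_hypergraph dual
  (remaining_vertices dual Vd t) (remaining_hyperedges dual Ed t).
have alp := alpha_gt0; have as0 : alpha s != 0 by rewrite gt_eqF.
suff /maximal_densestP[m1 m2] : [/\ subgraph qd (Es s) (Vs s), Es s != set0,
    wt (ewt qd) (Vs s) = (alpha s)^-1 * wt (vwt qd) (Es s)
  & forall E' V', subgraph qd E' V' -> E' != set0 ->
      wt (ewt qd) V' <= (alpha s)^-1 * wt (vwt qd) E' /\
      (Es s \subset E' -> Vs s \subset V' ->
       wt (ewt qd) V' = (alpha s)^-1 * wt (vwt qd) E' ->
       E' = Es s /\ V' = Vs s)].
  (* Quotient condition: if [v] lies in a remaining hyperedge, its block comes no later than that of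
     the hyperedge, so [v] remains too. *)
  split=> //; split; rewrite ?subsetDl // => v vH /set0Pn[e].
  case/setIP; rewrite inE => /andP[eH ve].
  have [i ei] := mem_blockE covE eH; rewrite (mem_dual_vertices t ei) => il.
  have [j vj ji] := supp_in_block ei ve.
  by rewrite (mem_dual_hyperedges t vj) (leq_trans ji).
have [_ _ eqs _] := spectral_bound s.
split; [split| exact: Es_neq0 | by rewrite /= eqs mulKf |].
- apply/subsetP => e es.
  by rewrite inE (mem_dual_vertices t es) leqnn (subsetP (block_sub covE s)).
- apply/subsetP => v vs.
  by rewrite inE (mem_dual_hyperedges t vs) leqnn (subsetP (block_sub covV s)).
(* A hyperedge through [v] has block index at least [s], and one remaining in the dual quotient has
   index at most [s]. *)
- move=> v vs; apply/subsetP => e /setIP[]; rewrite inE => /andP[eH ve].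
  have [i ei] := mem_blockE covE eH; rewrite (mem_dual_vertices t ei) => il.
  have si := supp_block_le ei ve vs.
  by have -> : s = i by apply/val_inj/anti_leq; rewrite il si.
move=> E' V' [sE sV sS] _ /=.
have eE' e : e \in E' -> exists2 i : 'I_k, e \in Es i & (i <= s)%N.
  move/(subsetP sE)/setIP => -[/(mem_blockE covE)[i ei]].
  by rewrite (mem_dual_vertices t ei); exists i.
have vV' v : v \in V' -> exists2 i : 'I_k, v \in Vs i & (i <= s)%N.
  move/(subsetP sV)/setIP => -[/(mem_blockE covV)[i vi]].
  by rewrite (mem_dual_hyperedges t vi); exists i.
have bound (j : 'I_k) : (j <= s)%N ->
    alpha j * wt (vwt H) (Vs j :&: V') <= wt (ewt H) (Es j :&: E').
  move=> js; apply: removal_bound js _ => v e i vV il ei ve.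
  apply: (subsetP (sS v vV)).
  apply/setIP; split; last by rewrite (mem_dual_vertices t ei).
  by rewrite inE ve (subsetP (block_sub covE i)).
have wV0 j : 0 <= wt (vwt H) (Vs j :&: V').
  by apply: wt_ge0 => v /setIP[/Vs_gt0].
have wE0 j : 0 <= wt (ewt H) (Es j :&: E').
  by apply: wt_ge0 => e /setIP[/Es_gt0].
have Vout (j : 'I_k) : (s < j)%N -> Vs j :&: V' = set0.
  move=> sj; apply/setP => v; rewrite !inE; apply/negP => /andP[vj /vV'[i vi]].
  by rewrite (block_inj disV vi vj) leqNgt sj.
have le_s (j : 'I_k) : (j <= s)%N -> alpha s <= alpha j.
  by rewrite leq_eqVlt => /orP[/eqP/val_inj->//|/alpha_decreasing/ltW].
have term j : alpha s * wt (vwt H) (Vs j :&: V') <= wt (ewt H) (Es j :&: E').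
  have [js|sj] := leqP j s; last by rewrite Vout // {1}/wt big_set0 mulr0 wE0.
  by apply: le_trans (bound j js); apply: ler_wpM2r (wV0 j) _ _ (le_s j js).
have sVH : V' \subset vertices H by apply: subset_trans sV (subsetIl _ _).
have sEH : E' \subset hyperedges H by apply: subset_trans sE (subsetIl _ _).
rewrite (wt_blocks covV disV _ sVH) (wt_blocks covE disE _ sEH).
split=> [|sEs sVs eq].
  by rewrite ler_pdivlMl // mulr_sumr ler_sum.
(* The blockwise differences are nonnegative and sum to zero, so each vanishes. *)
have eqj j : wt (ewt H) (Es j :&: E') = alpha s * wt (vwt H) (Vs j :&: V').
  apply/eqP; rewrite -subr_eq0; apply/eqP.
  have d0 i : 0 <= wt (ewt H) (Es i :&: E') - alpha s * wt (vwt H) (Vs i :&: V').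
    by rewrite subr_ge0.
  apply: (psumr_eq0P (P := xpredT) (fun i _ => d0 i)) => //.
  by rewrite sumrB -mulr_sumr eq mulVKf // subrr.
(* By [eqj], [bound] reads [alpha j * w <= alpha s * w] with [w] the weight of [Vs j :&: V']; as
   [alpha s < alpha j], this forces [w = 0]. *)
have Vlt (j : 'I_k) : (j < s)%N -> Vs j :&: V' = set0.
  move=> js; apply: (wt_eq0 (f := vwt H)) => [v /setIP[/Vs_gt0 //]|].
  apply/eqP; have := bound j (ltnW js); rewrite eqj.
  apply: contraTT; rewrite -ltNge => w0; rewrite ltr_pM2r ?alpha_decreasing //.
  by rewrite lt_def w0 wV0.
have Elt (j : 'I_k) : (j < s)%N -> Es j :&: E' = set0.
  move=> js; apply: (wt_eq0 (f := ewt H)) => [e /setIP[/Es_gt0 //]|].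
  by rewrite eqj Vlt // /wt big_set0 mulr0.
split; apply/eqP; rewrite eqEsubset ?sEs ?sVs andbT; apply/subsetP.
  move=> e eE; have [i ei] := eE' e eE; rewrite leq_eqVlt.
  case/orP=> [/eqP/val_inj<-//|/Elt/setP/(_ e)].
  by rewrite !inE ei eE.
move=> v vV; have [i vi] := vV' v vV; rewrite leq_eqVlt.
case/orP=> [/eqP/val_inj<-//|/Vlt/setP/(_ v)].
by rewrite !inE vi vV.
Qed.

End SpectralFacts.

Theorem theorem8 (R : realFieldType) (VT ET : finType)
    (H : whypergraph R VT ET) (k : nat)
    (Vs : 'I_k -> {set VT}) (Es : 'I_k -> {set ET}) (alpha : 'I_k -> R)
    (H_noniso : no_isolated H)
    (H_spec : spectral_decomposition H Vs Es alpha) :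
  [/\ decreasing_positive alpha,
      spectral_decomposition (dual_hypergraph H)
        (fun t : 'I_k => Es (rev_ord t)) (fun t : 'I_k => Vs (rev_ord t))
        (fun t : 'I_k => (alpha (rev_ord t))^-1)
    & decreasing_positive (fun t : 'I_k => (alpha (rev_ord t))^-1)].
Proof.
have a0 := alpha_gt0 H_noniso H_spec; have adec := alpha_decreasing H_spec.
split; first by [].
  by split; [apply: dual_partition H_spec | apply: dual_step].
split=> [i j ij|i]; last by rewrite invr_gt0.
rewrite ltf_pV2 ?posrE //; apply: adec.
by apply: ltn_sub2l; rewrite ?ltnS // (leq_ltn_trans ij (ltn_ord j)).
Qed.
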